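(* Let $\phi$ be a flow of a compact metric space $X$. (1) If $\Omega(\phi)\setminus Sing(\phi)$ is closed, then $h^*(\phi)=h(\phi)$. (2) If $\phi$ is singular-equicontinuous, then $h^*(\phi)=0$.
   Context: A flow is a continuous $\phi:\mathbb{R}\times X\to X$ with $\phi_0=\mathrm{id}$, $\phi_{t+s}=\phi_t\circ\phi_s$; $Sing(\phi)$ is the set of fixed points; $dist(z,A)=\inf_{a\in A}d(z,a)$. $x$ is nonwandering if $U\cap\bigcup_{t\ge T}\phi_t(U)\ne\emptyset$ for every $T>0$ and every neighborhood $U$ of $x$; $\Omega(\phi)$ is the set of nonwandering points. For compact $K\subset X$, $t>0$, $\epsilon>0$, let $r(t,\epsilon)$ be the minimal cardinality of $F\subset K$ with $K\subset\bigcup_{x\in F}\{y\in X: d(\phi_s(x),\phi_s(y))\le\epsilon\ \forall 0\le s\le t\}$, and $h(\phi,K)=\lim_{\epsilon\to0}\limsup_{t\to\infty}\frac1t\ln r(t,\epsilon)$; $h(\phi)=h(\phi,X)$ and $h^*(\phi)=\sup\{h(\phi,K): K\subset X\setminus Sing(\phi)\text{ compact}\}$. $\phi$ is singular-equicontinuous if for every $\epsilon>0$ there is $\delta>0$ such that $x,y\in X$ and $d(x,y)\le\delta\,dist(x,Sing(\phi))$ imply $d(\phi_t(x),\phi_t(y))\le\epsilon$ for all $t\in\mathbb{R}$. *)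

(* Defs.v *)
From HB Require Import structures.
From mathcomp Require Import all_boot all_order all_algebra finmap.
From mathcomp Require Import all_classical all_reals all_analysis.
Set Implicit Arguments. Unset Strict Implicit. Unset Printing Implicit Defensive.
Import Order.TTheory GRing.Theory Num.Theory.
Import numFieldTopology.Exports.
Local Open Scope classical_set_scope.
Local Open Scope ring_scope.

Section Flows.
Variables (R : realType) (X : metricType R).

Definition is_flow (phi : R -> X -> X) : Prop :=
  continuous (fun p : R * X => phi p.1 p.2) /\
  (forall x, phi 0 x = x) /\
  (forall t s x, phi (t + s) x = phi t (phi s x)).

Definition Sing (phi : R -> X -> X) : set X := [set x | forall t, phi t x = x].

(* dist(z, A) = inf_{a in A} d(z, a), in the extended reals (inf of empty = +oo) *)
Definition edist_set (z : X) (A : set X) : \bar R :=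
  ereal_inf [set (mdist z a)%:E | a in A].

Definition nonwandering (phi : R -> X -> X) (x : X) : Prop :=
  forall (T : R) (U : set X), 0 < T -> nbhs x U ->
    U `&` \bigcup_(t in [set t : R | T <= t]) (phi t @` U) !=set0.

Definition Omega (phi : R -> X -> X) : set X := [set x | nonwandering phi x].

Definition bowen_ball (phi : R -> X -> X) (t eps : R) (x : X) : set X :=
  [set y | forall s, 0 <= s <= t -> mdist (phi s x) (phi s y) <= eps].

(* r(t, eps): minimal cardinality of a finite F included in K whose Bowen balls
   cover K (+oo if there is no such finite F) *)
Definition span_number (phi : R -> X -> X) (K : set X) (t eps : R) : \bar R :=
  ereal_inf [set ((#|` F|)%:R)%:E | F in
    [set F : {fset X} | [set` F] `<=` K /\
                        K `<=` \bigcup_(x in [set` F]) bowen_ball phi t eps x]].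

Definition span_rate (phi : R -> X -> X) (K : set X) (eps : R) (t : R) : \bar R :=
  match span_number phi K t eps with
  | EFin n => (ln n / t)%:E
  | +oo%E => +oo%E
  | -oo%E => -oo%E
  end.

Definition span_limsup (phi : R -> X -> X) (K : set X) (eps : R) : \bar R :=
  limf_esup (span_rate phi K eps) (pinfty_nbhs R).

Definition entropy_on (phi : R -> X -> X) (K : set X) : \bar R :=
  lim (span_limsup phi K @ 0^'+).

Definition entropy (phi : R -> X -> X) : \bar R := entropy_on phi setT.

Definition entropy_star (phi : R -> X -> X) : \bar R :=
  ereal_sup [set entropy_on phi K | K in
               [set K : set X | compact K /\ K `<=` ~` Sing phi]].

Definition singular_equicontinuous (phi : R -> X -> X) : Prop :=
  forall eps : R, 0 < eps -> exists2 delta : R, 0 < delta &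
    forall x y : X, ((mdist x y)%:E <= delta%:E * edist_set x (Sing phi))%E ->
      forall t : R, mdist (phi t x) (phi t y) <= eps.

End Flows.

(* Main.v *)
(* Part (2): for a compact [K] off the singularities, equicontinuity makes the
   spanning numbers of [K] bounded in time.

   Part (1): this is Bowen's argument that entropy lives on the nonwandering set.
   Cover [Omega] by b Bowen balls of length T and the rest of [X] by finitely many
   wandering sets. An orbit of length kT visits the wandering sets a bounded
   number of times, so it has at most C (b + 1)^k codes and
   h(phi) <= ln (b + 1) / T. Here b is the sum of a spanning number of
   [Omega \ Sing], which is compact and off the singularities, and of a spanning
   number of [Sing], which does not depend on T. Let T go to infinity. *)

Require Import Defs.
From HB Require Import structures.
From mathcomp Require Import all_boot all_order all_algebra finmap.
From mathcomp Require Import all_classical all_reals all_analysis.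
Set Implicit Arguments. Unset Strict Implicit. Unset Printing Implicit Defensive.
Import Order.TTheory GRing.Theory Num.Theory.
Import numFieldTopology.Exports.
Local Open Scope classical_set_scope.
Local Open Scope ring_scope.

(** * Finite codings and finite subcovers *)

(** Keep one point of [K] for each attained code. When points with equal codes are Bowen-close,
    counting codes thus bounds a spanning set inside [K]. *)
Lemma finite_code_reps (T : choiceType) (A : finType) (K : set T) (c : T -> A)
    (S : {set A}) :
  (forall x, K x -> c x \in S) ->
  exists F : {fset T}, [/\ [set` F] `<=` K, (#|` F| <= #|S|)%N &
    forall x, K x -> exists2 y, y \in F & c y = c x].
Proof.
move=> cS.
have /choice[r rP] : forall a, exists o : option T,
    if o is Some y then K y /\ c y = a else forall y, K y -> c y <> a.
  move=> a; have [[y Ky]|n] := pselect (exists2 y, K y & c y = a).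
    by exists (Some y).
  by exists None => y Ky cy; apply: n; exists y.
exists (seq_fset tt (pmap r (enum S))); split.
- move=> y yF; have : y \in seq_fset tt (pmap r (enum S)) := yF.
  rewrite seq_fsetE mem_pmap => /mapP[a _ ra].
  by have := rP a; rewrite -ra => -[].
- rewrite size_seq_fset (leq_trans (size_undup _))// size_pmap.
  by rewrite (leq_trans (count_size _ _))// -cardE.
- move=> x Kx; have := rP (c x); case E : (r (c x)) => [y|] => [[Ky cy]|/(_ x Kx)//].
  exists y => //; rewrite seq_fsetE mem_pmap; apply/mapP; exists (c x) => //.
  by rewrite mem_enum cS.
Qed.

Lemma compact_fset_nbhs_cover (X : topologicalType) (K : set X) (V : X -> set X) :
  compact K -> (forall x, K x -> nbhs x (V x)) ->
  exists2 F : {fset X}, [set` F] `<=` K & K `<=` \bigcup_(x in [set` F]) V x.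
Proof.
move=> /compact_near_coveringP cK nV.
(* Finite subsets of [K], directed by inclusion: near each point of [K] all large enough [F] cover,
   and compactness makes this uniform over [K]. *)
pose G := filter_from [set F : {fset X} | [set` F] `<=` K]
  (fun F => [set F' : {fset X} | (F `<=` F')%fset]).
have GF : Filter G.
  apply: filter_from_filter; first by exists fset0.
  move=> F1 F2 F1K F2K; exists (F1 `|` F2)%fset.
    by move=> x; rewrite /= inE => /orP[/F1K|/F2K].
  by move=> F /= /fsubUsetP[F1F F2F].
have [|F FK] := cK {fset X} G (fun F x => (\bigcup_(y in [set` F]) V y) x) GF.
  move=> x Kx; exists (V x, [set F | x \in F]) => /=.
    split; first exact: nV.
    exists [fset x]%fset; first by move=> y /=; rewrite inE => /eqP ->.
    by move=> F /= /fsubsetP xF; apply: xF; rewrite inE.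
  by move=> [y F] /= [xy xF]; exists x.
move=> KF; exists F => //; apply: KF => /=; exact: fsubset_refl.
Qed.

(** * Upper limits at infinity *)

Section LimfEsup.
Variable R : realType.
Implicit Types f g : R -> \bar R.

Lemma limf_esup_pinfty_le f (c : \bar R) :
  (\forall t \near +oo, (f t <= c)%E) -> (limf_esup f (pinfty_nbhs R) <= c)%E.
Proof.
move=> fc; apply: ge_ereal_inf.
exists (ereal_sup (f @` [set t | (f t <= c)%E])); first by exists [set t | (f t <= c)%E].
by apply: ge_ereal_sup => _ [t /= ? <-].
Qed.

Lemma limf_esup_pinfty_lt f (c : \bar R) :
  (limf_esup f (pinfty_nbhs R) < c)%E -> \forall t \near +oo, (f t < c)%E.
Proof.
move=> /ereal_inf_lt[_ [A A0 <-]] Ac.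
apply: filterS A0 => t At; apply: le_lt_trans Ac.
by apply: ereal_sup_ubound; exists t.
Qed.

Lemma le_limf_esup_pinfty f g :
  (\forall t \near +oo, (f t <= g t)%E) -> (limf_esup f (pinfty_nbhs R) <= limf_esup g (pinfty_nbhs R))%E.
Proof.
move=> fg; apply: le_ereal_inf_tmp => _ [A A0 <-].
apply: limf_esup_pinfty_le; near=> t.
apply: (@le_trans _ _ (g t)); first by near: t.
by apply: ereal_sup_ubound; exists t => //; near: t.
Unshelve. all: by end_near. Qed.

Lemma limf_esup_pinfty_ge0 f :
  (\forall t \near +oo, (0 <= f t)%E) -> (0 <= limf_esup f (pinfty_nbhs R))%E.
Proof.
move=> f0; apply: le_ereal_inf_tmp => _ [A A0 <-].
have [t [At ft]] := filter_ex (filterI A0 f0).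
by apply: (le_trans ft); apply: ereal_sup_ubound; exists t.
Qed.

End LimfEsup.

Lemma ln_nat_le (R : realType) (m n : nat) :
  (m <= n)%N -> ln (m%:R : R) <= ln (n%:R : R).
Proof.
case: m => [|m] mn.
  (* By convention [ln 0 = 0], so monotonicity persists at 0 on the naturals. *)
  rewrite (ln0 (lexx _)); case: n mn => [|n] _; first by rewrite (ln0 (lexx _)).
  by rewrite ln_ge0// ler1n.
by rewrite ler_ln ?posrE ?ltr0n ?ler_nat//; exact: leq_trans mn.
Qed.

(** * Spanning sets and entropy *)

Section Span.
Variables (R : realType) (X : metricType R) (phi : R -> X -> X).
Implicit Types (K : set X) (t eps : R) (F : {fset X}).

Definition spanning K t eps F : Prop :=
  [set` F] `<=` K /\ K `<=` \bigcup_(x in [set` F]) bowen_ball phi t eps x.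

(** An infimum of a nonempty set of naturals is attained; that of the empty set is [+oo]. *)
Lemma span_numberP K t eps :
  (exists2 F, spanning K t eps F & span_number phi K t eps = (#|` F|%:R)%:E /\
     (forall F', spanning K t eps F' -> (#|` F| <= #|` F'|)%N)) \/
  ((forall F, ~ spanning K t eps F) /\ span_number phi K t eps = +oo%E).
Proof.
have [[F0 F0s]|n] := pselect (exists F, spanning K t eps F); [left|right].
  pose P n := `[< exists2 F, spanning K t eps F & #|` F| = n >].
  have exP : exists n, P n by exists #|` F0|; apply/asboolP; exists F0.
  case: (ex_minnP exP) => n /asboolP[F Fs Fn] nmin.
  have Fmin F' : spanning K t eps F' -> (#|` F| <= #|` F'|)%N.
    by move=> F's; rewrite Fn; apply: nmin; apply/asboolP; exists F'.
  exists F => //; split => //; apply/eqP; rewrite eq_le; apply/andP; split.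
    by apply: ereal_inf_lbound; exists F.
  apply: le_ereal_inf_tmp => _ [F' F's <-].
  by rewrite lee_fin ler_nat; exact: Fmin.
split; first by move=> F Fs; apply: n; exists F.
rewrite /span_number (_ : [set F : {fset X} | _] = set0) ?image_set0 ?ereal_inf0//.
by rewrite -subset0 => F Fs; apply: n; exists F.
Qed.

Lemma span_rate_le K t eps F : 0 < t -> spanning K t eps F ->
  (span_rate phi K eps t <= (ln #|` F|%:R / t)%:E)%E.
Proof.
move=> t0 Fs; rewrite /span_rate.
have [[F' _ [-> Fmin]]|[/(_ F)//]] := span_numberP K t eps.
by rewrite lee_fin ler_pM2r ?invr_gt0// ln_nat_le// Fmin.
Qed.

Lemma span_rate_ltP K t eps (c : R) : (span_rate phi K eps t < c%:E)%E ->
  exists2 F, spanning K t eps F & ln #|` F|%:R / t < c.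
Proof.
rewrite /span_rate.
have [[F Fs [-> _]]|[_ ->//]] := span_numberP K t eps.
by rewrite lte_fin; exists F.
Qed.

Lemma span_rate_ge0 K t eps : 0 < t -> (0 <= span_rate phi K eps t)%E.
Proof.
move=> t0; rewrite /span_rate.
have [[F Fs [-> _]]|[_ ->//]] := span_numberP K t eps.
by rewrite lee_fin divr_ge0 ?(ltW t0)// -[leLHS](ln0 (lexx 0)) (ln_nat_le R (leq0n _)).
Qed.

Lemma le_span_rate K K' t eps eps' : 0 < t ->
  (forall F, spanning K' t eps' F ->
     exists2 F', spanning K t eps F' & (#|` F'| <= #|` F|)%N) ->
  (span_rate phi K eps t <= span_rate phi K' eps' t)%E.
Proof.
move=> t0 h; rewrite [leRHS]/span_rate.
have [[F Fs [-> _]]|[_ ->]] := span_numberP K' t eps'; last exact: leey.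
have [F' F's F'F] := h _ Fs.
apply: le_trans (span_rate_le t0 F's) _.
by rewrite lee_fin ler_pM2r ?invr_gt0// ln_nat_le.
Qed.

Lemma span_limsup_ge0 K eps : (0 <= span_limsup phi K eps)%E.
Proof.
apply: limf_esup_pinfty_ge0; near=> t; apply: span_rate_ge0.
by near: t; exact: nbhs_pinfty_gt.
Unshelve. all: by end_near. Qed.

Lemma span_limsup_nonincreasing K eps eps' : eps <= eps' ->
  (span_limsup phi K eps' <= span_limsup phi K eps)%E.
Proof.
move=> ee; apply: le_limf_esup_pinfty; near=> t; apply: le_span_rate.
  by near: t; exact: nbhs_pinfty_gt.
move=> F [FK KF]; exists F => //; split => // x /KF[y Fy yx].
by exists y => // s /yx /le_trans; exact.
Unshelve. all: by end_near. Qed.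

(** The growth rate is monotone in [eps], so its limit at 0 is a supremum and entropies can be
    compared one [eps] at a time. *)
Lemma entropy_onE K :
  entropy_on phi K = ereal_sup (span_limsup phi K @` [set eps | 0 < eps]).
Proof.
rewrite /entropy_on; apply/cvg_lim => //.
have -> : [set eps : R | 0 < eps] = [set` Interval (BRight 0) (BInfty _ false)].
  by apply/seteqP; split => x /=; rewrite in_itv/= andbT.
apply: nonincreasing_at_right_cvge => // x y _ _; exact: span_limsup_nonincreasing.
Qed.

(* A set spanning [X] need not be included in [K]; replacing its points by
   points of [K] doubles the radius. *)
Lemma spanning_subset K t eps F : spanning setT t (eps / 2) F ->
  exists2 F', spanning K t eps F' & (#|` F'| <= #|` F|)%N.
Proof.
move=> [_ TF].
have /choice[c cP] : forall x, exists p : F, bowen_ball phi t (eps / 2) (val p) x.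
  by move=> x; have [p Fp px] := TF x I; exists (FSetSub Fp).
have [|F' [F'K F'F F'c]] := @finite_code_reps _ _ K c [set: F]%SET.
  by move=> x _; rewrite finset.inE.
exists F'; last by rewrite [leqRHS]cardfE -finset.cardsT.
split => // x /F'c[y F'y cyx]; exists y => // s st.
have := cP x s st; have := cP y s st; rewrite cyx => h1 h2.
rewrite (le_trans (metric_triangle _ (phi s (val (c x))) _))//.
by rewrite [eps]splitr lerD// metric_sym.
Qed.

Lemma entropy_on_le K : (entropy_on phi K <= entropy phi)%E.
Proof.
rewrite /entropy !entropy_onE; apply: ge_ereal_sup => _ [eps /= e0 <-].
apply: le_ereal_sup_tmp; exists (span_limsup phi setT (eps / 2)).
  by exists (eps / 2) => //=; rewrite divr_gt0.
apply: le_limf_esup_pinfty; near=> t; apply: le_span_rate.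
  by near: t; exact: nbhs_pinfty_gt.
exact: spanning_subset.
Unshelve. all: by end_near. Qed.

Lemma entropy_on_ge0 K : (0 <= entropy_on phi K)%E.
Proof.
rewrite entropy_onE; apply: le_ereal_sup_tmp.
by exists (span_limsup phi K 1); [exists 1 => //=|exact: span_limsup_ge0].
Qed.

End Span.

(* Weight a letter of [B] by 1 and a letter of [D] by 1/(#|D|+1): the total
   weight of all words is at most (#|B|+1)^k, while each word of [S] has weight
   at least (#|D|+1)^-P. *)
Lemma card_sparse_words (B D : finType) (k P : nat) (S : {set {ffun 'I_k -> B + D}}) :
  (forall f, f \in S -> (#|[set i | ~~ is_inl (f i)]%SET| <= P)%N) ->
  (#|S| <= #|D|.+1 ^ P * #|B|.+1 ^ k)%N.
Proof.
move=> SP; pose l : rat := (#|D|.+1%:R)^-1.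
have l0 : 0 < l by rewrite invr_gt0 ltr0n.
have l1 : l <= 1 by rewrite invf_le1 ?ltr0n// ler1n.
pose w (a : B + D) : rat := if ~~ is_inl a then l else 1.
have w0 a : 0 <= w a by rewrite /w; case: ifP => // _; exact: ltW.
have wS f : f \in S -> l ^+ P <= \prod_i w (f i).
  move=> fS; rewrite (bigID (fun i => ~~ is_inl (f i)))/=.
  rewrite [X in _ * X]big1 ?mulr1; last by move=> i /negbTE h; rewrite /w h.
  rewrite (eq_bigr (fun=> l)); last by move=> i h; rewrite /w h.
  rewrite prodr_const ler_wiXn2l ?(ltW l0)//.
  by have := SP f fS; rewrite cardsE.
(* All of [D] together weighs [#|D| / (#|D| + 1)], less than one letter of [B]. *)
have tot : \sum_a w a <= #|B|.+1%:R.
  rewrite big_sumType/= /w/= !sumr_const -natr1 lerD//.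
  by rewrite -mulr_natl ler_pdivrMr ?ltr0n// mul1r ler_nat.
rewrite -(ler_nat rat) natrM !natrX -ler_pdivrMl ?exprn_gt0 ?ltr0n//.
rewrite -exprVn -/l mulr_natr.
apply: (@le_trans _ _ (\sum_(f in S) \prod_i w (f i))).
  by rewrite -sumr_const ler_sum.
apply: (@le_trans _ _ (\sum_(f : {ffun 'I_k -> B + D}) \prod_i w (f i))).
  rewrite [leRHS](bigID (mem S))/= lerDl sumr_ge0// => f _.
  by rewrite prodr_ge0.
(* By distributivity the weights of all words sum to the [k]-th power of the alphabet's weight. *)
rewrite -(bigA_distr_bigA (fun=> w)) /= prodr_const card_ord.
by rewrite lerXn2r ?nnegrE ?sumr_ge0.
Qed.

(** * Singularities and equicontinuity *)

Section Flow.
Variables (R : realType) (X : metricType R) (phi : R -> X -> X).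
Hypotheses (compX : compact [set: X]) (flow_phi : is_flow phi).

Let phi_cont : continuous (fun p : R * X => phi p.1 p.2) := flow_phi.1.
Let phiD : forall t s x, phi (t + s) x = phi t (phi s x) := flow_phi.2.2.

(** Joint continuity gives closeness locally in time; compactness of [[0, t]] makes the neighborhood
    of [x] uniform in time. *)
Lemma bowen_ball_nbhs t eps x : 0 < eps -> nbhs x (bowen_ball phi t eps x).
Proof.
move=> e0; have e2 : 0 < eps / 2 by rewrite divr_gt0.
have /compact_near_coveringP := @segment_compact R 0 t.
move=> /(_ X (nbhs x) (fun y s => mdist (phi s x) (phi s y) <= eps) _) H.
have : \forall y \near x, `[0, t] `<=` [set s | mdist (phi s x) (phi s y) <= eps].
  apply: H => s0 _.
  have /metricType_numDomainType.cvgrPdist_lt/(_ _ e2) [[A B] /= [As0 Bx] AB] := @phi_cont (s0, x).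
  exists (A, B) => //= -[s y] /= [As By].
  rewrite (le_trans (metric_triangle _ (phi s0 x) _))//.
  rewrite [leRHS]splitr lerD// ltW// ?(AB (s, y))// metric_sym.
  by apply: (AB (s, x)); split => //=; exact: nbhs_singleton.
by apply: filterS => y h s st; apply: h; rewrite /= in_itv.
Qed.

Lemma Sing_closed : closed (Sing phi).
Proof.
rewrite (_ : Sing phi = \bigcap_(t in [set: R]) [set x | phi t x = x]).
  apply: closed_bigI => t _ x clx; apply: contrapT => /eqP ne.
  have d0 : 0 < mdist (phi t x) x / 2 by rewrite divr_gt0// mdist_gt0.
  have /metricType_numDomainType.cvgrPdist_lt/(_ _ d0) [[A B] /= [At Bx] AB] := @phi_cont (t, x).
  have [y [/= ty [By yx]]] : [set x | phi t x = x] `&` (B `&` ball x (mdist (phi t x) x / 2)) !=set0.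
    by apply: clx; apply: filterI => //; exact: nbhsx_ballx.
  have := AB (t, y) (conj (nbhs_singleton At) By); rewrite /= ty.
  move: yx; rewrite ballEmdist/= => xy ay.
  have := metric_triangle (phi t x) y x; rewrite leNgt => /negP; apply.
  by rewrite [ltRHS]splitr ltrD// metric_sym.
by apply/seteqP; split => x /= h t => [_|]; apply: h.
Qed.

(** A real lower bound is extracted because the distance is [+oo] when there are no
    singularities. *)
Lemma edist_Sing_gt0 x : ~ Sing phi x ->
  exists2 r : R, 0 < r & (r%:E <= edist_set x (Sing phi))%E.
Proof.
move=> nS; have : nbhs x (~` Sing phi).
  by apply: open_nbhs_nbhs; split => //; exact/closed_openC/Sing_closed.
move=> /nbhs_ballP[r /= r0 rS]; exists r => //.
apply: le_ereal_inf_tmp => _ [y Sy <-]; rewrite lee_fin leNgt; apply/negP => xy.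
by apply: (rS y) => //; rewrite ballEmdist.
Qed.

Lemma entropy_on_singular_equicontinuous (K : set X) :
  singular_equicontinuous phi -> compact K -> K `<=` ~` Sing phi ->
  (entropy_on phi K <= 0)%E.
Proof.
move=> se cK KS; rewrite entropy_onE; apply: ge_ereal_sup => _ [eps /= e0 <-].
have [d d0 dP] := se _ e0.
have [|F FK KF] := compact_fset_nbhs_cover
    (V := fun x => [set y | forall t, mdist (phi t x) (phi t y) <= eps]) cK.
  move=> x /KS/edist_Sing_gt0[r r0 rS].
  apply/nbhs_ballP; exists (d * r) => /=; first exact: mulr_gt0.
  move=> y; rewrite ballEmdist/= => xy t; apply: dP.
  rewrite (@le_trans _ _ (d * r)%:E) ?lee_fin ?(ltW xy)// EFinM.
  by rewrite lee_pmul2l// lte_fin.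
apply/lee_addgt0Pr => e e_gt0; rewrite add0e.
(* [F] serves every time [t], so the rate is at most [ln #|F| / t], which tends to 0. *)
apply: limf_esup_pinfty_le; near=> t.
have t0 : 0 < t by near: t; exact: nbhs_pinfty_gt.
apply: (@le_trans _ _ (ln #|` F|%:R / t)%:E).
  apply: span_rate_le => //; split => // x /KF[y Fy xy].
  by exists y => // s _; exact: xy.
rewrite lee_fin ler_pdivrMr// -(ler_pdivrMl _ _ e_gt0).
by near: t; apply: nbhs_pinfty_ge; exact: num_real.
Unshelve. all: by end_near. Qed.

(** * Coding orbits by wandering sets *)

Lemma wandering_nbhs x : ~ Omega phi x -> exists T (U : set X),
  nbhs x U /\ forall t y, T <= t -> U y -> ~ U (phi t y).
Proof.
move=> nO; apply: contrapT => h; apply: nO => T U T0 Ux; apply: contrapT => e.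
apply: h; exists T, U; split => // t y Tt Uy Uty; apply: e.
by exists (phi t y); split => //; exists t => //; exists y.
Qed.

(* Cover [X] by Bowen balls of length [T] around [F] and by wandering sets, and
   code [x] by the cover elements visited at times 0, T, 2T, ... A wandering set
   is visited only during a bounded time window, so codes are sparse words. *)
Lemma spanning_iterate T eps (F : {fset X}) : 0 < T -> 0 < eps ->
  Omega phi `<=` \bigcup_(p in [set` F]) bowen_ball phi T eps p ->
  exists C : nat, forall k : nat, exists2 F' : {fset X},
    spanning phi setT (k%:R * T) (4 * eps) F' & (#|` F'| <= C * #|` F|.+1 ^ k)%N.
Proof.
move=> T0 e0 OF.
(* The second component is a time after which a wandering set is never revisited; at nonwandering
   points it is a dummy 0. *)
have /choice[V VP] : forall y, exists VT : set X * R, nbhs y VT.1 /\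
    ((VT.1 `<=` \bigcup_(p in [set` F]) bowen_ball phi T (2 * eps) p) \/
     (VT.1 `<=` bowen_ball phi T eps y /\
      forall t z, VT.2 <= t -> VT.1 z -> ~ VT.1 (phi t z))).
  move=> y; have [/OF[p Fp py]|/wandering_nbhs[T1 [U [Uy UP]]]] := pselect (Omega phi y).
    exists (bowen_ball phi T eps y, 0); split => /=; first exact: bowen_ball_nbhs.
    left=> z yz; exists p => // s st.
    rewrite (le_trans (metric_triangle _ (phi s y) _))//.
    by rewrite mulr_natl mulr2n lerD//; [exact: py|exact: yz].
  exists (bowen_ball phi T eps y `&` U, T1); split => /=.
    by apply: filterI => //; exact: bowen_ball_nbhs.
  right; split=> [z []//|t z tT [_ Uz] [_]]; exact: UP.
have [|D _ TD] := compact_fset_nbhs_cover (V := fun y => (V y).1) compX.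
  by move=> y _; have [] := VP y.
have /choice[c cP] : forall x, exists a : F + D, match a with
    | inl p => bowen_ball phi T (2 * eps) (val p) x
    | inr y => [/\ (V (val y)).1 x, (V (val y)).1 `<=` bowen_ball phi T eps (val y) &
      forall t z, (V (val y)).2 <= t -> (V (val y)).1 z -> ~ (V (val y)).1 (phi t z)]
    end.
  move=> x; have [y Dy Vyx] := TD x I.
  have [_ [/(_ _ Vyx)[p Fp px]|[Vb Vw]]] := VP y; first by exists (inl (FSetSub Fp)).
  by exists (inr (FSetSub Dy)).
(* Common bound, in steps of length [T], for all return times. *)
pose q := (\max_(y : D) (Num.truncn ((V (val y)).2 / T)).+1)%N.
have qP (y : D) : (V (val y)).2 <= q%:R * T.
  rewrite -ler_pdivrMr// (le_trans (ltW (truncnS_gt _)))// ler_nat.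
  exact: (leq_bigmax y).
pose P := (#|{: F + D}| * q.+1)%N.
(* The extra factor [#|F| + 1] pays for words of length [k + 1]: the times 0 to [kT] are all coded,
   so that [s = kT] is covered. *)
exists (#|{: D}|.+1 ^ P * #|` F|.+1)%N => k.
pose it x := [ffun i : 'I_k.+1 => c (phi (i%:R * T) x)].
pose S := [set f : {ffun 'I_k.+1 -> F + D} | (#|[set i | ~~ is_inl (f i)]| <= P)%N]%SET.
have itS x : it x \in S.
  rewrite finset.inE /P -(card_ord q.+1) -card_prod.
  (* Two visits with the same letter and the same residue would be at least [q + 1] steps apart, a
     forbidden return. *)
  apply: (leq_card_in (fun i => (it x i, inord (i %% q.+1) : 'I_q.+1))) => i j.
  rewrite !finset.inE.
  wlog ij : i j / (i < j)%N.
    move=> wl hi hj h; have [ij|ji|/val_inj//] := ltngtP i j.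
      exact: wl.
    by apply/esym/wl.
  move=> hi _ [cij /(congr1 val)]; rewrite /= !inordK ?ltn_pmod// => mij.
  exfalso; move: hi cij; rewrite !ffunE.
  have := cP (phi (i%:R * T) x); have := cP (phi (j%:R * T) x).
  case: (c (phi (i%:R * T) x)) => // y hj [Vi _ Vw] _ cij.
  move: hj; rewrite -cij => -[Vj _ _].
  have jiq : (q < j - i)%N.
    rewrite ltnNge; apply/negP => jiq.
    have : (q.+1 %| j - i)%N by rewrite -eqn_mod_dvd ?(ltnW ij)// eq_sym; apply/eqP.
    by move=> /dvdn_leq; rewrite subn_gt0 => /(_ ij); rewrite leqNgt ltnS jiq.
  apply: (Vw ((j - i)%:R * T) _ _ Vi).
    by rewrite (le_trans (qP y))// ler_pM2r// ler_nat ltnW.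
  by rewrite -phiD -mulrDl -natrD subnK// ltnW.
have [|F' [_ F'S F'P]] := @finite_code_reps _ _ setT it S.
  by move=> x _; exact: itS.
exists F'; last first.
  rewrite (leq_trans F'S)// (leq_trans (card_sparse_words (P := P) _))//.
    by move=> f; rewrite finset.inE.
  by rewrite expnS mulnA !cardfE.
split => // x _; have [y F'y yx] := F'P x I; exists y => // s /andP[s0 sk].
pose i := Num.truncn (s / T).
have sT0 : 0 <= s / T by rewrite divr_ge0// ltW.
have ik : (i < k.+1)%N.
  by rewrite ltnS /i truncn_le_nat (le_lt_trans (y := k%:R)) ?ltr_nat// ler_pdivrMr.
have /andP[i1 i2] := truncn_itv sT0.
have r0 : 0 <= s - i%:R * T <= T.
  rewrite subr_ge0 -ler_pdivlMr// i1/= lerBlDl.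
  by rewrite -[X in _ + X]mul1r -mulrDl natr1 -ler_pdivrMr// ltW.
have sE z : phi s z = phi (s - i%:R * T) (phi (i%:R * T) z).
  by rewrite -phiD subrK.
have := congr1 (fun f : {ffun 'I_k.+1 -> F + D} => f (Ordinal ik)) yx.
rewrite /it !ffunE /= => cyx.
have := cP (phi (i%:R * T) x); have := cP (phi (i%:R * T) y); rewrite cyx !sE.
(* A shared [F] letter costs [2 * eps] twice, a shared wandering letter only [eps] twice. *)
case: (c _) => [p|p].
  move=> /(_ _ r0) hy /(_ _ r0) hx.
  rewrite (le_trans (metric_triangle _ (phi (s - i%:R * T) (val p)) _))//.
  by rewrite metric_sym (le_trans (lerD hy hx))// -mulrDl -natrD.
move=> [/[swap] Vb /Vb/(_ _ r0) hy _] [/Vb/(_ _ r0) hx _ _].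
rewrite (le_trans (metric_triangle _ (phi (s - i%:R * T) (val p)) _))//.
rewrite metric_sym (le_trans (lerD hy hx))// -mulr2n -[eps *+ 2]mulr_natl.
by rewrite ler_pM2r// ler_nat.
Qed.

Lemma span_limsup_le_ln T eps (F : {fset X}) : 0 < T -> 0 < eps ->
  Omega phi `<=` \bigcup_(p in [set` F]) bowen_ball phi T eps p ->
  (span_limsup phi setT (4 * eps) <= (ln (#|` F|.+1%:R) / T)%:E)%E.
Proof.
move=> T0 e0 /(spanning_iterate T0 e0)[C CP].
set L := ln _; have L0 : 0 <= L by rewrite ln_ge0// ler1n.
pose M : R := ln C.+1%:R + L.
apply/lee_addgt0Pr => e e_gt0; rewrite -EFinD.
(* With [k <= t / T + 1] blocks, the logarithm is at most [M + (t / T) * L], and [M / t] falls below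
   [e]. Using [C.+1] keeps the logarithm's argument positive. *)
apply: limf_esup_pinfty_le; near=> t.
have t0 : 0 < t by near: t; exact: nbhs_pinfty_gt.
pose k := (Num.truncn (t / T)).+1.
have tk : t <= k%:R * T by rewrite -ler_pdivrMr// ltW// truncnS_gt.
have kt : k%:R <= t / T + 1.
  have /andP[h _] := truncn_itv (ltW (divr_gt0 t0 T0)).
  by rewrite /k -natr1 lerD2r.
have [F' F's F'C] := CP k.
have {}F's : spanning phi setT t (4 * eps) F'.
  split => // x /(F's.2)[y F'y xy]; exists y => // s /andP[s0 st].
  by apply: xy; rewrite s0 (le_trans st).
apply: le_trans (span_rate_le t0 F's) _; rewrite lee_fin ler_pdivrMr//.
have := @ln_nat_le R _ (C.+1 * #|` F|.+1 ^ k) (leq_trans F'C (leq_mul (leqnSn C) (leqnn _))).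
move/le_trans; apply.
rewrite natrM natrX lnM ?posrE ?exprn_gt0 ?ltr0n// lnXn ?ltr0n// -/L -[L *+ k]mulr_natl.
apply: (@le_trans _ _ (M + t / T * L)).
  by rewrite /M -addrA lerD2l -[X in X + _]mul1r -mulrDl ler_wpM2r// addrC.
rewrite mulrDl addrC lerD//; first by rewrite mulrAC [leRHS]mulrAC [t * L]mulrC.
rewrite -(ler_pdivrMl _ _ e_gt0).
by near: t; apply: nbhs_pinfty_ge; exact: num_real.
Unshelve. all: by end_near. Qed.

(** * Discarding the singularities *)

(** Points of [Sing phi] do not move, so a finite [eps]-net there spans for every [T]. *)
Lemma Sing_spanning eps : 0 < eps -> exists F : {fset X}, forall T,
  spanning phi (Sing phi) T eps F.
Proof.
move=> e0.
have cS : compact (Sing phi) by exact: (subclosed_compact Sing_closed compX).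
have [|F FS SF] := compact_fset_nbhs_cover (V := fun x => ball x eps) cS.
  by move=> x _; exact: nbhsx_ballx.
exists F => T; split => // x Sx; have [p Fp px] := SF x Sx.
exists p => // s _; rewrite Sx (FS p Fp).
by move: px; rewrite ballEmdist => /ltW.
Qed.

Lemma span_limsup_nonwandering (L : set X) eps : 0 < eps ->
  Omega phi `<=` L `|` Sing phi ->
  (span_limsup phi setT (4 * eps) <= span_limsup phi L eps)%E.
Proof.
move=> e0 OL; have [FS FSP] := Sing_spanning e0.
have := span_limsup_ge0 phi L eps.
case E : (span_limsup phi L eps) => [r| |]// _; last exact: leey.
apply/lee_addgt0Pr => e e_gt0; rewrite -EFinD.
have : (span_limsup phi L eps < (r + e / 2)%:E)%E.
  by rewrite E lte_fin ltrDl divr_gt0.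
move=> /limf_esup_pinfty_lt rt.
(* Chosen since [a + b + 1 <= a * (b + 2)] for [a >= 1]: the singular part adds only a constant to
   the logarithm, and [M / T <= e / 2] for large [T]. *)
pose M : R := ln (#|` FS|.+2)%:R.
near (pinfty_nbhs R) => T.
have T0 : 0 < T by near: T; exact: nbhs_pinfty_gt.
have MT : M / (e / 2) <= T by near: T; apply: nbhs_pinfty_ge; exact: num_real.
have : (span_rate phi L eps T < (r + e / 2)%:E)%E by near: T.
move=> /span_rate_ltP[FL [_ LF] lnF].
apply: le_trans (span_limsup_le_ln (F := (FL `|` FS)%fset) T0 e0 _) _.
  move=> x /OL[/LF[p Fp px]|/(FSP T).2[p Fp px]]; exists p => //=.
    by rewrite inE; apply/orP; left.
  by rewrite inE; apply/orP; right.
rewrite lee_fin [e in r + e]splitr addrA.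
apply: (@le_trans _ _ ((ln #|` FL|%:R + M) / T)); last first.
  rewrite mulrDl lerD ?(ltW lnF)// ler_pdivrMr// mulrC -ler_pdivrMr//.
  by rewrite divr_gt0.
rewrite ler_pM2r ?invr_gt0//.
have FU : (#|` (FL `|` FS)%fset| <= #|` FL| + #|` FS|)%N.
  by rewrite cardfsU leq_subr.
(* The product bound fails for empty [FL]; there [ln 0 = 0] gives the estimate directly. *)
have [F0|F0] := posnP #|` FL|.
  rewrite F0 (ln0 (lexx 0)) add0r ln_nat_le// ltnW// !ltnS (leq_trans FU)//.
  by rewrite F0 add0n.
rewrite -lnM ?posrE ?ltr0n// -natrM ln_nat_le//.
rewrite mulnS mulnS -addn1 (leq_trans (leq_add FU (leqnn 1)))//.
rewrite -addnA leq_add2l addn1 -add1n leq_add// leq_pmull//.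
Unshelve. all: by end_near. Qed.

Lemma entropy_le_nonwandering (L : set X) : Omega phi `<=` L `|` Sing phi ->
  (entropy phi <= entropy_on phi L)%E.
Proof.
move=> OL; rewrite /entropy !entropy_onE; apply: ge_ereal_sup => _ [eps /= e0 <-].
have e4 : 0 < eps / 4 by rewrite divr_gt0.
apply: le_ereal_sup_tmp; exists (span_limsup phi L (eps / 4)); first by exists (eps / 4).
by have := span_limsup_nonwandering e4 OL; rewrite mulrC divfK ?pnatr_eq0.
Qed.

End Flow.

Theorem mainTheorem11 (R : realType) (X : metricType R) (phi : R -> X -> X) :
  compact [set: X] -> is_flow phi ->
  (closed (Omega phi `\` Sing phi) -> entropy_star phi = entropy phi) /\
  (singular_equicontinuous phi -> entropy_star phi = 0%E).
Proof.
move=> cX fphi; split => [clO|se]; apply/eqP; rewrite eq_le; apply/andP; split.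
- by apply: ge_ereal_sup => _ [K _ <-]; exact: entropy_on_le.
- apply: (le_trans (entropy_le_nonwandering (L := Omega phi `\` Sing phi) cX fphi _)).
    by move=> x Ox; have [Sx|nSx] := pselect (Sing phi x); [right|left].
  apply: ereal_sup_ubound; exists (Omega phi `\` Sing phi) => //.
  by split; [exact: subclosed_compact clO cX _|move=> x []].
- apply: ge_ereal_sup => _ [K [cK KS] <-].
  exact: entropy_on_singular_equicontinuous.
(* The empty set always competes in the supremum, which is therefore nonnegative. *)
- apply: le_ereal_sup_tmp; exists (entropy_on phi set0); last exact: entropy_on_ge0.
  by exists set0 => //; split => //; exact: compact0.
Qed.
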